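(* Fix $E>0$ and $q_a\in\mathbb{R}$. For each $\varepsilon>0$ let $q_\varepsilon\colon\mathbb{R}\to\mathbb{R}$ solve $$q_\varepsilon''(t)=-\frac1\varepsilon V'\!\left(\frac{q_\varepsilon(t)}{\varepsilon}\right),\quad t\in\mathbb{R},$$ subject to $q_\varepsilon(0)=q_a$ and $q_\varepsilon'(0)=p_\varepsilon>0$, where $p_\varepsilon$ is chosen such that the conserved energy $\frac12|q_\varepsilon'(t)|^2+V(q_\varepsilon(t)/\varepsilon)$ equals $E$ for all $\varepsilon$. Then, for every $\varepsilon>0$, $$\sup_{t\in\mathbb{R}}|q_\varepsilon(t)-q(t)|\le \frac{C_E}{\sigma(E)}\,\varepsilon,$$ where $q(t)=\frac{t}{\sigma(E)}+q_a$ for $t\in\mathbb{R}$.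
   Context: $V\in C^2(\mathbb{R})$ is $1$-periodic with $\max V=0$. For $E>0$, $$\sigma(E):=\int_0^1\frac{1}{\sqrt{2(E-V(\gamma))}}\,d\gamma,\qquad C_E:=\frac{2}{\sqrt{2E}}.$$ *)

(* Defs.v *)
From Stdlib Require Import Reals.
From Coquelicot Require Import Coquelicot.
Open Scope R_scope.

(* [ex_derive_n V 2 x] does not imply differentiability of [V] itself, so each
   order is required separately. *)
Definition C2 (V : R -> R) : Prop :=
  (forall x, ex_derive V x) /\
  (forall x, ex_derive (Derive V) x) /\
  (forall x, continuous (Derive_n V 2) x).

Definition periodic1 (V : R -> R) : Prop := forall x, V (x + 1) = V x.

Definition is_max (V : R -> R) (m : R) : Prop :=
  (forall x, V x <= m) /\ (exists x, V x = m).

Definition sigma_ (V : R -> R) (E : R) : R :=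
  RInt (fun gamma => 1 / sqrt (2 * (E - V gamma))) 0 1.

Definition C_ (E : R) : R := 2 / sqrt (2 * E).

(* [Derive] is a total function, hence the explicit existence of [q']. *)
Definition solves (V : R -> R) (eps : R) (q : R -> R) : Prop :=
  forall t, ex_derive q t /\
    is_derive (Derive q) t (- (1 / eps) * Derive V (q t / eps)).

Definition energy (V : R -> R) (eps : R) (q : R -> R) (t : R) : R :=
  1 / 2 * (Rabs (Derive q t)) ^ 2 + V (q t / eps).

Definition sup_R (f : R -> R) : Rbar := Lub_Rbar (fun y => exists t, y = f t).

(* Main.v *)
Require Import Defs.
From Stdlib Require Import Reals.
From Coquelicot Require Import Coquelicot.
From Stdlib Require Import Lra ZArith.
Open Scope R_scope.

(** Conservation of energy turns the second-order equation into a first-order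
    one.  Since [E - V >= E > 0], the velocity never vanishes, so it stays
    positive and [q' = 1 / g (q / eps)] with [g x = 1 / sqrt (2 (E - V x))].
    Hence, for the primitive [G x] of [g], the function
    [eps * G (q t / eps) - t] is constant: the time needed to go from [qa] to
    [q t] is [eps * (G (q t / eps) - G (qa / eps))].

    As [g] is 1-periodic with mean [sigma], the function [G x - sigma * x] is
    1-periodic, and as [0 <= g <= M] with [M = 1 / sqrt (2 E)], its
    oscillation is at most [M].  Therefore
    [|t - sigma * (q t - qa)| <= eps * M], and dividing by [sigma] gives the
    bound, even with [M] in place of [C_E = 2 M]. *)

(** * Primitives of periodic functions *)

Lemma is_derive_zero_const (f : R -> R) :
  (forall x, is_derive f x 0) -> forall x y, f x = f y.
Proof.
  intros Hf x y.
  destruct (MVT_gen f x y (fun _ => 0)) as [c [_ Hc]].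
  - intros; apply Hf.
  - intros z _; apply continuity_pt_filterlim.
    apply (ex_derive_continuous f z); exists 0; apply Hf.
  - lra.
Qed.

Lemma periodic_IZR (f : R -> R) :
  (forall x, f (x + 1) = f x) -> forall (n : Z) x, f (x + IZR n) = f x.
Proof.
  intros Hf n; induction n as [|n IH|n IH] using Z.peano_ind; intros x.
  - f_equal; ring.
  - rewrite succ_IZR, <- (IH x), <- (Hf (x + IZR n)); f_equal; ring.
  - rewrite <- (IH x), <- (Hf (x + IZR (Z.pred n))); f_equal.
    unfold Z.pred; rewrite plus_IZR; ring.
Qed.

Lemma increment_bound (G g : R -> R) (M : R) :
  (forall x, is_derive G x (g x)) -> (forall x, 0 <= g x <= M) ->
  forall x y, x <= y -> 0 <= G y - G x <= M * (y - x).
Proof.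
  intros HG Hg x y Hxy.
  destruct (MVT_gen G x y g) as [c [_ Hc]].
  - intros; apply HG.
  - intros z _; apply continuity_pt_filterlim.
    apply (ex_derive_continuous G z); exists (g z); apply HG.
  - rewrite Hc; specialize (Hg c); split.
    + apply Rmult_le_pos; lra.
    + apply Rmult_le_compat_r; lra.
Qed.

(** A primitive of a 1-periodic function gains the same amount over every
    period. *)
Lemma primitive_period_increment (G g : R -> R) :
  (forall x, is_derive G x (g x)) -> (forall x, g (x + 1) = g x) ->
  forall x, G (x + 1) - G x = G 1 - G 0.
Proof.
  intros HG Hg x.
  assert (Hc : forall z, is_derive (fun s => G (s + 1) - G s) z 0).
  { intros z.
    evar_last.
    - eapply (is_derive_minus (V := R_NormedModule)); [|apply HG].
      apply (is_derive_comp G (fun s => s + 1)); [apply HG|].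
      auto_derive; [exact I|reflexivity].
    - rewrite Hg; unfold minus, plus, opp, scal; simpl; unfold mult; simpl; ring. }
  rewrite (is_derive_zero_const _ Hc x 0); f_equal; f_equal; ring.
Qed.

(** The deviation of the primitive of a periodic function from its mean slope
    never exceeds the bound on its slope times the length of a period. *)
Lemma primitive_deviation_bound (G g : R -> R) (M : R) :
  (forall x, is_derive G x (g x)) -> (forall x, g (x + 1) = g x) ->
  (forall x, 0 <= g x <= M) ->
  forall x y, Rabs (G y - G x - (G 1 - G 0) * (y - x)) <= M.
Proof.
  intros HG Hper Hg x y.
  set (s := G 1 - G 0).
  assert (Hs : 0 <= s <= M).
  { generalize (increment_bound G g M HG Hg 0 1); unfold s; lra. }
  set (H := fun z => G z - s * z).
  assert (HH : forall z, H (z + 1) = H z).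
  { intros z; unfold H.
    generalize (primitive_period_increment G g HG Hper z); fold s; lra. }
  (* Shift [y] by an integer into [x, x + 1]. *)
  set (n := Int_part (y - x)).
  set (y' := y + IZR (- n)).
  assert (Hy' : 0 <= y' - x <= 1).
  { unfold y'; rewrite opp_IZR.
    generalize (base_Int_part (y - x)); fold n; lra. }
  assert (HHy : H y' = H y) by (apply periodic_IZR, HH).
  replace (G y - G x - s * (y - x)) with (H y - H x) by (unfold H; ring).
  rewrite <- HHy; unfold H.
  destruct (increment_bound G g M HG Hg x y' ltac:(lra)) as [Hlo Hhi].
  assert (M * (y' - x) <= M * 1) by (apply Rmult_le_compat_l; lra).
  assert (0 <= s * (y' - x)) by (apply Rmult_le_pos; lra).
  assert (s * (y' - x) <= s * 1) by (apply Rmult_le_compat_l; lra).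
  apply Rabs_le; lra.
Qed.

(** * Newtonian dynamics in the oscillating potential *)

Lemma energy_conserved (V : R -> R) (eps : R) (q : R -> R) :
  0 < eps -> (forall x, ex_derive V x) -> solves V eps q ->
  forall s t, energy V eps q s = energy V eps q t.
Proof.
  intros Heps HV Hq; apply is_derive_zero_const; intros t.
  destruct (Hq t) as [Hq1 Hq2].
  apply is_derive_ext with
    (fun t => 1 / 2 * (Derive q t) ^ 2 + V (q t / eps)).
  { intros u; unfold energy; rewrite pow2_abs; reflexivity. }
  evar_last.
  - eapply (is_derive_plus (V := R_NormedModule)).
    + apply is_derive_scal; apply is_derive_pow; exact Hq2.
    + apply (is_derive_comp V (fun u => q u / eps)).
      * apply Derive_correct, HV.
      * apply (is_derive_ext (fun u => / eps * q u)).
        { intros u; apply Rmult_comm. }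
        apply is_derive_scal, Derive_correct, Hq1.
  - unfold plus, scal; simpl; unfold mult; simpl; field; lra.
Qed.

(** A trajectory whose energy lies above the maximum of the potential never
    turns back. *)
Lemma velocity_pos (V : R -> R) (eps E : R) (q : R -> R) :
  0 < eps -> (forall x, ex_derive V x) -> (forall x, V x < E) ->
  solves V eps q -> 0 < Derive q 0 -> energy V eps q 0 = E ->
  forall t, 0 < Derive q t.
Proof.
  intros Heps HV HVE Hq H0 HE t.
  destruct (Rlt_le_dec 0 (Derive q t)) as [Ht|Ht]; [exact Ht|exfalso].
  destruct (IVT_gen (Derive q) 0 t 0) as [c [_ Hc]].
  - intros z; apply continuity_pt_filterlim.
    apply (ex_derive_continuous (Derive q) z).
    eexists; apply Hq.
  - rewrite Rmin_right, Rmax_left; lra.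
  - generalize (energy_conserved V eps q Heps HV Hq c 0).
    rewrite HE; unfold energy; rewrite Hc, Rabs_R0.
    generalize (HVE (q c / eps)); lra.
Qed.

Lemma velocity_eq (V : R -> R) (eps E : R) (q : R -> R) :
  0 < eps -> (forall x, ex_derive V x) -> (forall x, V x < E) ->
  solves V eps q -> 0 < Derive q 0 -> energy V eps q 0 = E ->
  forall t, Derive q t = sqrt (2 * (E - V (q t / eps))).
Proof.
  intros Heps HV HVE Hq H0 HE t.
  assert (Hpos := velocity_pos V eps E q Heps HV HVE Hq H0 HE t).
  generalize (energy_conserved V eps q Heps HV Hq t 0).
  rewrite HE; unfold energy; rewrite pow2_abs; intros HEt.
  symmetry; apply sqrt_lem_1; [|lra|].
  - generalize (HVE (q t / eps)); lra.
  - simpl in HEt; lra.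
Qed.

(** The reciprocal speed is the density of travel time with respect to
    position. *)
Lemma travel_time (V : R -> R) (eps E : R) (q G : R -> R) :
  0 < eps -> (forall x, ex_derive V x) -> (forall x, V x < E) ->
  solves V eps q -> 0 < Derive q 0 -> energy V eps q 0 = E ->
  (forall x, is_derive G x (1 / sqrt (2 * (E - V x)))) ->
  forall t, eps * (G (q t / eps) - G (q 0 / eps)) = t.
Proof.
  intros Heps HV HVE Hq H0 HE HG t.
  assert (Hc : forall z, is_derive (fun u => eps * G (q u / eps) - u) z 0).
  { intros z; evar_last.
    - eapply (is_derive_minus (V := R_NormedModule)); [|apply (is_derive_id (K := R_AbsRing))].
      apply is_derive_scal.
      apply (is_derive_comp G (fun u => q u / eps)); [apply HG|].
      apply (is_derive_ext (fun u => / eps * q u)).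
      { intros u; apply Rmult_comm. }
      apply is_derive_scal, Derive_correct, Hq.
    - rewrite (velocity_eq V eps E q Heps HV HVE Hq H0 HE z).
      assert (Hs : 0 < sqrt (2 * (E - V (q z / eps)))).
      { apply sqrt_lt_R0; generalize (HVE (q z / eps)); lra. }
      unfold minus, plus, opp, scal, one; simpl; unfold mult; simpl.
      field; lra. }
  generalize (is_derive_zero_const _ Hc t 0); simpl; lra.
Qed.

(** * Homogenization estimate *)

Theorem theorem2p2 (V : R -> R) (HV : C2 V) (Hper : periodic1 V)
  (Hmax : is_max V 0) (E : R) (HE : 0 < E) (qa : R)
  (q : R -> R -> R) (p : R -> R)
  (Hode : forall eps, 0 < eps -> solves V eps (q eps))
  (Hq0 : forall eps, 0 < eps -> q eps 0 = qa)
  (Hp0 : forall eps, 0 < eps -> Derive (q eps) 0 = p eps)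
  (Hp : forall eps, 0 < eps -> 0 < p eps)
  (Henergy : forall eps, 0 < eps -> energy V eps (q eps) 0 = E) :
  forall eps, 0 < eps ->
    Rbar_le (sup_R (fun t => Rabs (q eps t - (t / sigma_ V E + qa))))
            (Finite (C_ E / sigma_ V E * eps)).
Proof.
  intros eps Heps.
  destruct HV as [HV _]; destruct Hmax as [Hmax _].
  assert (HVE : forall x, V x < E) by (intros x; generalize (Hmax x); lra).
  set (g := fun x => 1 / sqrt (2 * (E - V x))).
  set (M := 1 / sqrt (2 * E)).
  assert (HsE : 0 < sqrt (2 * E)) by (apply sqrt_lt_R0; lra).
  assert (Hs : forall x, 0 < sqrt (2 * (E - V x))).
  { intros x; apply sqrt_lt_R0; generalize (HVE x); lra. }
  assert (Hg0 : forall x, 0 < g x).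
  { intros x; apply Rdiv_lt_0_compat; [lra|apply Hs]. }
  assert (HgM : forall x, g x <= M).
  { intros x; unfold g, M, Rdiv; apply Rmult_le_compat_l; [lra|].
    apply Rinv_le_contravar; [exact HsE|].
    apply sqrt_le_1_alt; generalize (Hmax x); lra. }
  assert (Hgper : forall x, g (x + 1) = g x).
  { intros x; unfold g; rewrite Hper; reflexivity. }
  assert (Hgcont : forall x, continuous g x).
  { intros x; apply (ex_derive_continuous g x); unfold g; auto_derive.
    generalize (HVE x) (Hs x); intros H1 H2.
    repeat split; try apply HV; unfold Rminus in *; lra. }
  set (G := fun x => RInt g 0 x).
  assert (Hint : forall x, ex_RInt g 0 x).
  { intros x; apply (ex_RInt_continuous g); intros z _; apply Hgcont. }
  assert (HG : forall x, is_derive G x (g x)).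
  { intros x; apply (is_derive_RInt g G 0 x); [|apply Hgcont].
    apply filter_forall; intros z; apply (RInt_correct g), Hint. }
  assert (Hsigma : sigma_ V E = G 1 - G 0).
  { unfold G; rewrite RInt_point.
    change (zero : R) with 0; rewrite Rminus_0_r; reflexivity. }
  set (s := sigma_ V E) in *.
  assert (Hspos : 0 < s).
  { unfold s, sigma_; apply RInt_gt_0; [lra| |].
    - intros x _; apply Hg0.
    - intros x _; apply Hgcont. }
  assert (HM : 0 < M) by (apply Rdiv_lt_0_compat; lra).
  apply Lub_Rbar_correct.
  intros y [t ->]; simpl.
  assert (Htime := travel_time V eps E (q eps) G Heps HV HVE (Hode eps Heps)
    ltac:(rewrite Hp0; auto) (Henergy eps Heps) HG t).
  assert (Hdev := primitive_deviation_bound G g M HG Hgper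
    (fun x => conj (Rlt_le _ _ (Hg0 x)) (HgM x))
    (q eps 0 / eps) (q eps t / eps)).
  rewrite <- Hsigma in Hdev.
  set (D := G (q eps t / eps) - G (q eps 0 / eps)
            - s * (q eps t / eps - q eps 0 / eps)) in Hdev.
  replace (q eps t - (t / s + qa)) with (- (eps / s * D)).
  2:{ (* Only the [t] of [t / s] is replaced by the travel time. *)
      unfold D; rewrite <- Htime at 4; rewrite <- (Hq0 eps Heps); field; lra. }
  rewrite Rabs_Ropp, Rabs_mult.
  assert (Hes : 0 < eps / s) by (apply Rdiv_lt_0_compat; lra).
  rewrite (Rabs_pos_eq (eps / s)) by lra.
  replace (C_ E / s * eps) with (eps / s * (2 * M))
    by (unfold C_, M; field; lra).
  apply Rmult_le_compat_l; lra.
Qed.
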